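(* Let $R$ be a commutative ring with unity, let $L = Id(R)$ be the multiplicative lattice of all ideals of $R$, and let $I$ be an ideal of $R$. Then $I$ is an $n$-ideal of $R$ if and only if $I$ is an $n$-element of $L$.
   Context: A proper ideal $I$ of a commutative ring $R$ with unity is an $n$-ideal if for all $a,b\in R$, $ab\in I$ with $a\notin\sqrt{0}$ (the nilradical of $R$) implies $b\in I$. A multiplicative lattice is a complete lattice $L$ (least element $0$, greatest element $1$) with a commutative, associative binary operation $\cdot$ that distributes over arbitrary joins and satisfies $a\cdot 1=a$ for all $a$. An element $i$ is proper if $i\neq 1$. $L_*$ denotes the set of compact elements of $L$ ($c$ is compact if $c\le\bigvee_\alpha a_\alpha$ implies $c\le a_{\alpha_1}\vee\dots\vee a_{\alpha_n}$ for finitely many indices). $(a]=\{x\in L: x\le a\}$. In a $c$-lattice (a multiplicative lattice in which $1$ is compact, every element is a join of compact elements, and the product of two compact elements is compact), the radical of $a$ is $\sqrt{a}=\bigvee\{x\in L_*: x^n\le a \text{ for some } n\in\mathbb{N}\}$. The lattice $Id(R)$ of all ideals of $R$, ordered by inclusion and with ideal product as multiplication, is a $c$-lattice. A proper element $i$ of $L$ is an $n$-element if for all $a,b\in L_*$, $a\cdot b\le i$ with $a\notin(\sqrt{0}\,]$ implies $b\le i$. *)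

(* Defs.v *)
From HB Require Import structures.
From mathcomp Require Import all_boot all_order all_algebra.
From mathcomp Require Import boolp classical_sets.

Set Implicit Arguments.
Unset Strict Implicit.
Unset Printing Implicit Defensive.

Import Order.TTheory GRing.Theory.

Local Open Scope classical_set_scope.
Local Open Scope order_scope.

HB.mixin Record TBLattice_isComplete d (T : Type) of Order.TBLattice d T := {
  bigjoin : set T -> T;
  bigjoinP : forall A : set T, isLub A (bigjoin A);
}.

#[short(type="completeLatticeType")]
HB.structure Definition CompleteLattice d :=
  { T of Order.TBLattice d T & TBLattice_isComplete d T }.

HB.mixin Record CompleteLattice_isMult d (T : Type) of CompleteLattice d T := {
  lmul : T -> T -> T;
  lmulA : associative lmul;
  lmulC : commutative lmul;
  lmulx1 : right_id \top lmul;
  lmul_bigjoinr : forall (a : T) (A : set T),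
    lmul a (bigjoin A) = bigjoin [set lmul a x | x in A];
}.

#[short(type="multLatticeType")]
HB.structure Definition MultLattice d :=
  { T of CompleteLattice d T & CompleteLattice_isMult d T }.

(* The set L_* of compact elements; the finite subfamily may be empty, so     *)
(* that \bot is compact.                                                      *)
Definition compact_elements d (L : completeLatticeType d) : set L :=
  [set c | forall A : set L, c <= bigjoin A ->
     exists2 s : seq L, [set` s] `<=` A & c <= \join_(x <- s) x].
Arguments compact_elements {d} L.

HB.mixin Record MultLattice_isCLattice d (T : Type) of MultLattice d T := {
  compact_top : compact_elements T \top;
  compact_generated : forall a : T,
    exists2 A : set T, A `<=` compact_elements T & a = bigjoin A;
  compactM : forall a b : T, compact_elements T a -> compact_elements T b ->
    compact_elements T (lmul a b);
}.

#[short(type="cLatticeType")]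
HB.structure Definition CLattice d :=
  { T of MultLattice d T & MultLattice_isCLattice d T }.

Definition lpow d (L : multLatticeType d) (x : L) (n : nat) : L :=
  iterop n lmul x \top.

Definition downset d (L : porderType d) (a : L) : set L := [set x | x <= a].

(* The exponent n = 0 is harmless here: lpow x 0 = \top <= a forces a = \top, *)
(* and then n = 1 works as well.                                              *)
Definition lradical d (L : cLatticeType d) (a : L) : L :=
  bigjoin [set x | compact_elements L x /\ exists n : nat, lpow x n <= a].

Definition n_element d (L : cLatticeType d) (i : L) : Prop :=
  i <> \top /\
  forall a b : L, compact_elements L a -> compact_elements L b ->
    lmul a b <= i -> ~ downset (lradical \bot) a -> b <= i.

(* Ideals.  MathComp's idealr_closed only covers proper ideals with a boolean *)
(* membership predicate, so it cannot be used for the lattice of all ideals.  *)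

Section Ideals.
Local Open Scope ring_scope.
Variable R : comPzRingType.

Definition is_ideal (A : set R) : Prop :=
  [/\ A 0, forall x y, A x -> A y -> A (x + y)
    & forall a x, A x -> A (a * x)].

Record ideal : Type := Ideal {
  ideal_set :> R -> Prop;
  idealP : is_ideal ideal_set
}.

Lemma ideal_inj (I J : ideal) : ideal_set I = ideal_set J -> I = J.
Proof.
by case: I J => [A pA] [B pB] /= AB; subst B; congr Ideal; apply: Prop_irrelevance.
Qed.

Lemma ideal0 (I : ideal) : I 0. Proof. by case: (idealP I). Qed.
Lemma idealD (I : ideal) x y : I x -> I y -> I (x + y).
Proof. by case: (idealP I) => _ + _; apply. Qed.
Lemma idealMl (I : ideal) a x : I x -> I (a * x).
Proof. by case: (idealP I) => _ _; apply. Qed.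
Lemma idealMr (I : ideal) a x : I x -> I (x * a).
Proof. by rewrite mulrC; exact: idealMl. Qed.

Lemma is_ideal_smallest (A : set R) : is_ideal (smallest is_ideal A).
Proof.
split=> [B [[B0 _ _] _] // | x y Ax Ay B BA | a x Ax B BA].
  by case: (BA) => -[_ BD _] _; apply: BD; [apply: Ax|apply: Ay].
by case: (BA) => -[_ _ BM] _; apply: BM; apply: Ax.
Qed.

Definition ideal_span (A : set R) : ideal := Ideal (is_ideal_smallest A).

Lemma sub_ideal_span (A : set R) : A `<=` ideal_span A.
Proof. exact: sub_gen_smallest. Qed.

Lemma ideal_spanP (A : set R) (I : ideal) : A `<=` I -> ideal_span A `<=` I.
Proof. by move=> AI; apply: smallest_sub => //; apply: idealP. Qed.

Lemma is_ideal_zero : is_ideal [set 0].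
Proof. by split=> [//|x y -> ->|a x ->] /=; rewrite ?addr0 ?mulr0. Qed.

Lemma is_ideal_setT : is_ideal [set: R].
Proof. by []. Qed.

Lemma is_idealI (I J : ideal) : is_ideal (I `&` J).
Proof.
split=> [|x y [? ?] [? ?]|a x [? ?]].
- by split; apply: ideal0.
- by split; apply: idealD.
- by split; apply: idealMl.
Qed.

Definition ideal_prod (I J : ideal) : ideal :=
  ideal_span [set x * y | x in I & y in J].

Definition ideal_sup (A : set ideal) : ideal :=
  ideal_span (\bigcup_(I in A) ideal_set I).

Definition nilradical : set R := [set a | exists n : nat, a ^+ n = 0].

Definition n_ideal (I : ideal) : Prop :=
  ideal_set I <> [set: R] /\
  forall a b : R, I (a * b) -> ~ nilradical a -> I b.

End Ideals.

HB.instance Definition _ (R : comPzRingType) := gen_eqMixin (ideal R).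
HB.instance Definition _ (R : comPzRingType) := gen_choiceMixin (ideal R).

Fact ideal_display : Order.disp_t. Proof. exact: Order.Disp tt tt. Qed.

Section IdealLattice.
Variable R : comPzRingType.
Implicit Types I J K : ideal R.

Definition ideal_le I J : bool := `[< ideal_set I `<=` ideal_set J >].

Lemma ideal_leP I J : reflect (ideal_set I `<=` ideal_set J) (ideal_le I J).
Proof. exact: asboolP. Qed.

Fact ideal_le_refl : reflexive ideal_le.
Proof. by move=> I; apply/ideal_leP. Qed.

Fact ideal_le_anti : antisymmetric ideal_le.
Proof.
by move=> I J /andP[/ideal_leP IJ /ideal_leP JI]; apply: ideal_inj; apply/seteqP.
Qed.

Fact ideal_le_trans : transitive ideal_le.
Proof.
move=> J I K /ideal_leP IJ /ideal_leP JK; apply/ideal_leP.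
exact: subset_trans JK.
Qed.

HB.instance Definition _ := Order.Le_isPOrder.Build ideal_display (ideal R)
  ideal_le_refl ideal_le_anti ideal_le_trans.

Lemma leidP I J : reflect (ideal_set I `<=` ideal_set J) (I <= J).
Proof. exact: ideal_leP. Qed.

Definition ideal_meet I J : ideal R := Ideal (is_idealI I J).
Definition ideal_join I J : ideal R := ideal_sup [set I; J].

Lemma ideal_supP (A : set (ideal R)) : isLub A (ideal_sup A).
Proof.
split=> [I AI|J ubJ]; apply/leidP.
  by move=> x Ix; apply: sub_ideal_span; exists I.
by apply: ideal_spanP => x [I AI Ix]; move/leidP: (ubJ I AI); apply.
Qed.

Fact ideal_meetP I J K : (I <= ideal_meet J K) = (I <= J) && (I <= K).
Proof.
apply/leidP/andP => [IJK|[/leidP IJ /leidP IK] x Ix].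
  by split; apply/leidP => x /IJK[].
by split; [apply: IJ|apply: IK].
Qed.

Fact ideal_joinP I J K : (ideal_join I J <= K) = (I <= K) && (J <= K).
Proof.
have [ubIJ lubIJ] := ideal_supP [set I; J].
apply/idP/andP => [IJK|[IK JK]].
  by split; apply: le_trans IJK; apply: ubIJ; [left|right].
by apply: lubIJ => H [->|->].
Qed.

HB.instance Definition _ := Order.POrder_MeetJoin_isLattice.Build
  ideal_display (ideal R) ideal_meetP ideal_joinP.

Fact ideal_le0 I : Ideal (is_ideal_zero R) <= I.
Proof. by apply/leidP => _ ->; apply: ideal0. Qed.

Fact ideal_leT I : I <= Ideal (is_ideal_setT R).
Proof. exact/leidP. Qed.

HB.instance Definition _ :=
  Order.hasBottom.Build ideal_display (ideal R) ideal_le0.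
HB.instance Definition _ :=
  Order.hasTop.Build ideal_display (ideal R) ideal_leT.

HB.instance Definition _ :=
  TBLattice_isComplete.Build ideal_display (ideal R) ideal_supP.

Local Open Scope ring_scope.

Lemma ideal_prodP I J K :
  reflect (forall x y, I x -> J y -> K (x * y)) (ideal_prod I J <= K)%O.
Proof.
apply: (iffP (leidP _ _)) => [IJK x y Ix Jy|IJK].
  by apply: IJK; apply: sub_ideal_span; exists x => //; exists y.
by apply: ideal_spanP => _ [x Ix [y Jy <-]]; apply: IJK.
Qed.

Lemma mem_ideal_prod I J x y : I x -> J y -> ideal_prod I J (x * y).
Proof. by move: x y; apply/ideal_prodP. Qed.

(* The ideal quotient (K : c). *)
Lemma is_ideal_colon K c : is_ideal [set x | K (c * x)].
Proof.
split=> [|x y|a x] /=; first by rewrite mulr0; apply: ideal0.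
  by rewrite mulrDr; apply: idealD.
by rewrite mulrCA; apply: idealMl.
Qed.

Definition ideal_colon K c : ideal R := Ideal (is_ideal_colon K c).

Lemma ideal_colonI K c x : K (c * x) -> ideal_colon K c x.
Proof. by []. Qed.

Fact ideal_prodC : commutative (@ideal_prod R).
Proof.
by move=> I J; apply: le_anti; apply/andP; split; apply/ideal_prodP => x y Ix Jy;
  rewrite mulrC; apply: mem_ideal_prod.
Qed.

Lemma ideal_prod_leA I J K :
  (ideal_prod I (ideal_prod J K) <= ideal_prod (ideal_prod I J) K)%O.
Proof.
apply/ideal_prodP => x z Ix.
pose Q := (ideal_colon (ideal_prod (ideal_prod I J) K) x).
suff /leidP : (ideal_prod J K <= Q)%O by apply.
apply/ideal_prodP => y w Jy Kw; apply: ideal_colonI; rewrite mulrA.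
by apply: mem_ideal_prod => //; apply: mem_ideal_prod.
Qed.

Fact ideal_prodA : associative (@ideal_prod R).
Proof.
move=> I J K; apply: le_anti; rewrite ideal_prod_leA /=.
rewrite ideal_prodC [ideal_prod I J]ideal_prodC.
by rewrite [ideal_prod I _]ideal_prodC [ideal_prod J K]ideal_prodC ideal_prod_leA.
Qed.

Fact ideal_prodx1 : right_id \top%O (@ideal_prod R).
Proof.
move=> I; apply: le_anti; apply/andP; split.
  by apply/ideal_prodP => x y Ix _; apply: idealMr.
by apply/leidP => x Ix; rewrite -[x]mulr1; apply: mem_ideal_prod.
Qed.

Fact ideal_prod_sup I (A : set (ideal R)) :
  ideal_prod I (bigjoin A) = bigjoin [set ideal_prod I J | J in A].
Proof.
have [ub lub] := ideal_supP [set ideal_prod I J | J in A].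
have [ubA lubA] := ideal_supP A.
apply: le_anti; apply/andP; split.
  apply/ideal_prodP => x y Ix.
  pose Q := (ideal_colon (bigjoin [set ideal_prod I J | J in A]) x).
  suff /leidP : (bigjoin A <= Q)%O by apply.
  apply: lubA => J AJ; apply/leidP => z Jz; apply: ideal_colonI.
  have /leidP : (ideal_prod I J <= bigjoin [set ideal_prod I J | J in A])%O.
    by apply: ub; exists J.
  by apply; apply: mem_ideal_prod.
apply: lub => _ [J AJ <-]; apply/ideal_prodP => x y Ix Jy.
apply: mem_ideal_prod => //.
by have /leidP := ubA J AJ; apply.
Qed.

HB.instance Definition _ := CompleteLattice_isMult.Build ideal_display (ideal R)
  ideal_prodA ideal_prodC ideal_prodx1 ideal_prod_sup.

Lemma ideal_span_le (A : set R) I : (ideal_span A <= I)%O <-> A `<=` I.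
Proof.
split=> [/leidP AI|AI]; last by apply/leidP; apply: ideal_spanP.
by apply: subset_trans AI; apply: sub_ideal_span.
Qed.

Lemma mem_bigjoin (A : set (ideal R)) x : (bigjoin A : ideal R) x ->
  exists2 s : seq (ideal R), [set` s] `<=` A & (\join_(I <- s) I)%O x.
Proof.
pose S := [set x | exists2 s : seq (ideal R),
  [set` s] `<=` A & (\join_(I <- s) I)%O x].
have idS : is_ideal S.
  split=> [|y z [s sA ys] [t tA zt]|a y [s sA ys]].
  - by exists [::] => //; apply: ideal0.
  - exists (s ++ t) => [I /=|]; first by rewrite mem_cat => /orP[/sA|/tA].
    rewrite big_cat; apply: idealD.
      by have /leidP := leUl (\join_(I <- s) I)%O (\join_(I <- t) I)%O; apply.
    by have /leidP := leUr (\join_(I <- t) I)%O (\join_(I <- s) I)%O; apply.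
  - by exists s => //; apply: idealMl.
suff /leidP : (bigjoin A <= Ideal idS)%O by apply.
apply: (ideal_supP A).2 => I AI; apply/leidP => y Iy.
exists [:: I]; last by rewrite big_seq1.
by move=> J /=; rewrite inE => /eqP->.
Qed.

Lemma compact_span (r : seq R) :
  compact_elements (ideal R) (ideal_span [set` r]).
Proof.
move=> A /ideal_span_le rA.
suff [s sA rs] : exists2 s : seq (ideal R),
    [set` s] `<=` A & [set` r] `<=` (\join_(I <- s) I)%O.
  by exists s => //; apply/ideal_span_le.
elim: r rA => [|x r IHr] rA; first by exists [::].
have [|s sA rs] := IHr; first by move=> y yr; apply: rA; rewrite /= inE yr orbT.
have [|t tA xt] := @mem_bigjoin A x; first by apply: rA; rewrite /= mem_head.
exists (t ++ s) => [I /=|y /=]; first by rewrite mem_cat => /orP[/tA|/sA].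
rewrite big_cat inE => /orP[/eqP->|yr].
  by have /leidP := leUl (\join_(I <- t) I)%O (\join_(I <- s) I)%O; apply.
have /leidP := leUr (\join_(I <- s) I)%O (\join_(I <- t) I)%O.
by apply; apply: rs.
Qed.

Lemma bigjoin_principal I :
  I = bigjoin [set ideal_span [set` [:: x]] | x in ideal_set I].
Proof.
apply: le_anti; apply/andP; split.
  apply/leidP => x Ix.
  have [ub _] := ideal_supP [set ideal_span [set` [:: x]] | x in ideal_set I].
  have /leidP := ub (ideal_span [set` [:: x]]) (ex_intro2 _ _ x Ix erefl).
  by apply; apply: sub_ideal_span; rewrite /= mem_head.
apply: (ideal_supP _).2 => _ [x Ix <-]; apply/ideal_span_le => y /=.
by rewrite inE => /eqP->.
Qed.

Lemma compact_fg I : compact_elements (ideal R) I <->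
  exists r : seq R, I = ideal_span [set` r].
Proof.
split=> [cI|[r ->]]; last exact: compact_span.
have [|s sA Is] := cI [set ideal_span [set` [:: x]] | x in ideal_set I].
  by rewrite -bigjoin_principal.
suff [r rI sr] : exists2 r : seq R,
    [set` r] `<=` I & (\join_(J <- s) J <= ideal_span [set` r])%O.
  exists r; apply: le_anti; rewrite (le_trans Is sr) /=.
  exact/ideal_span_le.
elim: s sA {Is} => [|J s IHs] sA.
  by exists [::] => //; rewrite big_nil le0x.
have [|r rI sr] := IHs; first by move=> K Ks; apply: sA; rewrite /= inE Ks orbT.
have [|x Ix xJ] := sA J; first by rewrite /= mem_head.
exists (x :: r) => [y /=|]; first by rewrite inE => /orP[/eqP->|/rI].
rewrite big_cons leUx -xJ; apply/andP; split.
  apply/ideal_span_le => y /= /[!inE] /eqP->.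
  by apply: sub_ideal_span; rewrite /= mem_head.
apply: le_trans sr _; apply/ideal_span_le => y yr.
by apply: sub_ideal_span; rewrite /= inE yr orbT.
Qed.

Fact ideal_compact_top : compact_elements (ideal R) \top%O.
Proof.
apply/compact_fg; exists [:: 1]; apply: le_anti; rewrite lex1 andbT.
apply/leidP => x _; rewrite -[x]mulr1; apply: idealMl.
by apply: sub_ideal_span; rewrite /= mem_head.
Qed.

Fact ideal_compact_generated I :
  exists2 A, A `<=` compact_elements (ideal R) & I = bigjoin A.
Proof.
exists [set ideal_span [set` [:: x]] | x in ideal_set I].
  by move=> _ [x _ <-]; apply: compact_span.
exact: bigjoin_principal.
Qed.

Lemma ideal_prod_span (A B : set R) : ideal_prod (ideal_span A) (ideal_span B) =
  ideal_span [set x * y | x in A & y in B].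
Proof.
apply: le_anti; apply/andP; split; last first.
  by apply/ideal_span_le => _ [x Ax [y By <-]]; apply: mem_ideal_prod;
    apply: sub_ideal_span.
set K := ideal_span [set x * y | x in A & y in B].
apply/ideal_prodP => x y xA.
suff /leidP : (ideal_span B <= (ideal_colon K x))%O by apply.
apply/ideal_span_le => {}y By; apply: ideal_colonI; rewrite mulrC.
suff /leidP : (ideal_span A <= (ideal_colon K y))%O by apply.
apply/ideal_span_le => {xA}x Ax; apply: ideal_colonI; rewrite mulrC.
by apply: sub_ideal_span; exists x => //; exists y.
Qed.

Fact ideal_compactM I J : compact_elements (ideal R) I ->
  compact_elements (ideal R) J -> compact_elements (ideal R) (lmul I J).
Proof.
move=> /compact_fg[r ->] /compact_fg[s ->]; apply/compact_fg.
exists [seq x * y | x <- r, y <- s].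
rewrite [lmul _ _]ideal_prod_span; congr ideal_span.
apply/seteqP; split=> [_ [x xr [y ys <-]]|z /= /allpairsP[[x y] [xr ys ->]]].
  by apply/allpairsP; exists (x, y).
by exists x => //; exists y.
Qed.

HB.instance Definition _ := MultLattice_isCLattice.Build ideal_display (ideal R)
  ideal_compact_top ideal_compact_generated ideal_compactM.

End IdealLattice.

(* Main.v *)
Require Import Defs.
From mathcomp Require Import all_boot all_order all_algebra.
From mathcomp Require Import boolp classical_sets.

(** Both notions say that a product lies in [I] only if its first factor is
    nilpotent or its second factor lies in [I]; one quantifies over elements,
    the other over compact, i.e. finitely generated, ideals.  Principal ideals
    translate elements into compact ideals: [<a><b> = <ab>], and [<b> <= I] iff
    [b] lies in [I].  Conversely, an ideal [A] that is not below the radical of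
    [0] contains a single non-nilpotent element [x]; if [AB <= I], then [xy] is
    in [I] for every [y] of [B], so that [B <= I].

    What makes the two nilpotency conditions match is [lradicalE]: the
    lattice-theoretic radical, a join of compact ideals, has as elements exactly
    the [x] with a power in the given ideal, so that the radical of [0] is the
    nilradical. *)

Set Implicit Arguments.
Unset Strict Implicit.
Unset Printing Implicit Defensive.

Import Order.TTheory GRing.Theory.

Local Open Scope classical_set_scope.
Local Open Scope ring_scope.

Lemma lpowS d (L : multLatticeType d) (x : L) n :
  lpow x n.+1 = lmul x (lpow x n).
Proof. by case: n => [|n] //; rewrite [lpow x 0]/lpow /= lmulx1. Qed.

Section IdealRadical.
Variable R : comPzRingType.
Implicit Types (I J K : ideal R) (x y : R).

(** The generator is given as a one-element sequence so that [compact_span]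
    makes these ideals compact. *)
Definition principal x : ideal R := ideal_span [set` [:: x]].

Lemma principal_leP x I : (principal x <= I)%O <-> I x.
Proof.
split=> [/ideal_span_le|Ix]; first by apply; rewrite /= mem_head.
by apply/ideal_span_le => y /=; rewrite inE => /eqP->.
Qed.

Lemma mem_principal x : principal x x.
Proof. exact/principal_leP. Qed.

Lemma lmul_leP I J K :
  (lmul I J <= K)%O <-> forall x y, I x -> J y -> K (x * y).
Proof. by split=> /ideal_prodP. Qed.

Lemma lmul_principal x y : lmul (principal x) (principal y) = principal (x * y).
Proof.
rewrite [lmul _ _]ideal_prod_span; congr ideal_span.
apply/seteqP; split=> [_ [u /= + [v /= + <-]]|z /=]; rewrite !mem_seq1.
  by move=> /eqP-> /eqP->.
by move=> /eqP->; exists x; [|exists y]; rewrite /= ?mem_seq1.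
Qed.

Lemma lpow_principal x n : lpow (principal x) n = principal (x ^+ n).
Proof.
elim: n => [|n IHn]; last by rewrite lpowS IHn lmul_principal exprS.
rewrite expr0; apply: le_anti; rewrite lex1 andbT.
by apply/leidP => y _; rewrite -[y]mulr1; apply: idealMl; apply: mem_principal.
Qed.

Lemma mem_lpow I x n : I x -> lpow I n (x ^+ n).
Proof.
move=> Ix; elim: n => [//|n IHn]; rewrite lpowS exprS.
by apply: mem_ideal_prod.
Qed.

Lemma idealX_le I x m n : (m <= n)%N -> I (x ^+ m) -> I (x ^+ n).
Proof. by move=> mn Ixm; rewrite -(subnK mn) exprD; apply: idealMl. Qed.

(** Each monomial [x ^ i * y ^ j] of [(x + y) ^ (m + n)] has [i + j = m + n],
    hence [m <= i] or [n <= j], and is in [K] as soon as [x ^ m] and [y ^ n]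
    are. *)
Lemma is_ideal_radical K : is_ideal [set x | exists n, K (x ^+ n)].
Proof.
split=> [|x y [m Kx] [n Ky]|a x [n Kx]] /=.
- by exists 1%N; rewrite expr1; apply: ideal0.
- exists (m + n)%N; rewrite exprDn.
  apply: (big_ind (ideal_set K)) => [|u v|i _]; first exact: ideal0.
    exact: idealD.
  rewrite -mulr_natl; apply: idealMl.
  have [le_ni|lt_in] := leqP n i; first by apply/idealMl/(idealX_le le_ni).
  by rewrite mulrC; apply/idealMl/(idealX_le _ Kx); rewrite -addnBA ?leq_addr // ltnW.
- by exists n; rewrite exprMn; apply: idealMl.
Qed.

(** The elements with a power in [K] form an ideal that contains every compact
    ideal of the defining join; conversely, such an element generates one of
    those compact ideals. *)
Lemma lradicalE K x : (lradical K : ideal R) x <-> exists n, K (x ^+ n).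
Proof.
have [ub lub] := bigjoinP
  [set J : ideal R | compact_elements _ J /\ exists n, (lpow J n <= K)%O].
split.
  suff /leidP : (lradical K <= Ideal (is_ideal_radical K))%O by apply.
  apply: lub => J [_ [n /leidP JnK]]; apply/leidP => y Jy.
  by exists n; apply/JnK/mem_lpow.
move=> [n Kxn]; apply/principal_leP; apply: ub.
by split; [exact: compact_span|exists n; rewrite lpow_principal; apply/principal_leP].
Qed.

Lemma lradical_bot : ideal_set (lradical \bot%O) = @nilradical R.
Proof. by apply/funext => x; apply/propext; apply: lradicalE. Qed.

Lemma ideal_topP I : I = \top%O <-> ideal_set I = [set: R].
Proof. by split=> [->|IT] //; apply: ideal_inj. Qed.

End IdealRadical.

Theorem theorem3p9 (R : comPzRingType) (I : ideal R) :
  n_ideal I <-> n_element I.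
Proof.
split=> -[properI nI]; (split; first by move=> /ideal_topP).
  move=> A B _ _ /lmul_leP ABI A_nonnil; apply/leidP => y By.
  have [x Ax x_nonnil] : exists2 x, A x & ~ nilradical x.
    apply: contrapT => noX; apply: A_nonnil; apply/leidP; rewrite lradical_bot.
    by move=> x Ax; apply: contrapT => x_nonnil; apply: noX; exists x.
  by apply: (nI x) => //; apply: ABI.
move=> a b Iab a_nonnil; apply/principal_leP.
apply: (nI (principal a) (principal b)); try exact: compact_span.
  by rewrite lmul_principal; apply/principal_leP.
by move=> /principal_leP; rewrite lradical_bot.
Qed.
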